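(* Let $c>0$ and $\beta\in(0,2)$, and let $k$ be the power type kernel $k(j)=\frac{c}{|j|^{1+\beta}}$ for $j\in\mathbb{Z}\setminus\{0\}$, $k(0)=0$. Then the corresponding operator $\mathcal{L}$ fails to satisfy $CD(0,d)$ for all finite $d>0$.
   Context: A kernel is a function $k:\mathbb{Z}\to[0,\infty)$ with $k(0)=0$, $k(-j)=k(j)$ for all $j\in\mathbb{N}$, and $0<|k|_1:=\sum_{j\in\mathbb{Z}}k(j)<\infty$. The associated operator is $\mathcal{L}u(x)=\sum_{j\in\mathbb{Z}}k(j)\big(u(x+j)-u(x)\big)$, $x\in\mathbb{Z}$, and the iterated carré du champ operator is given by $\Gamma_2(u)(x)=\frac14\sum_{j,l\in\mathbb{Z}}k(j)k(l)\big(u(x+j+l)-u(x+j)-u(x+l)+u(x)\big)^2\in[0,\infty]$. A function $u:\mathbb{Z}\to\mathbb{R}$ is admissible for $CD(0,d)$ at $x\in\mathbb{Z}$ if $\sum_{j\in\mathbb{Z}}k(j)|u(x+j)|<\infty$. For $d\in(0,\infty)$, $\mathcal{L}$ satisfies $CD(0,d)$ if $\Gamma_2(u)(x)\ge\frac1d\big(\mathcal{L}u(x)\big)^2$ for every $x\in\mathbb{Z}$ and every $u$ admissible at $x$; it fails to satisfy $CD(0,d)$ if this does not hold. *)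

(* Defs.v *)
From mathcomp Require Import all_boot all_order all_algebra.
From mathcomp Require Import all_classical all_reals all_analysis.

Set Implicit Arguments.
Unset Strict Implicit.
Unset Printing Implicit Defensive.
Import Order.TTheory GRing.Theory Num.Theory.

Local Open Scope classical_set_scope.
Local Open Scope ring_scope.

Record kernel (R : realType) := Kernel {
  kernel_fun :> int -> R;
  kernel_ge0 : forall j, 0 <= kernel_fun j;
  kernel0 : kernel_fun 0 = 0;
  kernelN : forall j : nat, kernel_fun (- j%:Z) = kernel_fun j%:Z;
  kernel_mass_gt0 : (0 < \esum_(j in [set: int]) (kernel_fun j)%:E)%E;
  kernel_mass_fin : (\esum_(j in [set: int]) (kernel_fun j)%:E < +oo)%E
}.

(* [\esum] is a supremum of finite sums, hence only meaningful for nonnegative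
   terms; a signed absolutely convergent sum is the difference of the sums of
   the positive and negative parts. The value is junk if the family is not
   absolutely summable. *)
Definition zsum (R : realType) (f : int -> R) : R :=
  fine (\esum_(j in [set: int]) (Num.max (f j) 0)%:E) -
  fine (\esum_(j in [set: int]) (Num.max (- f j) 0)%:E).

Definition admissible (R : realType) (k : kernel R) (u : int -> R) (x : int) :
    Prop :=
  (\esum_(j in [set: int]) (k j * `|u (x + j)|)%:E < +oo)%E.

(* The sum is absolutely convergent when u is admissible at x, which is the
   only case used in [CD0]. *)
Definition gen (R : realType) (k : kernel R) (u : int -> R) (x : int) : R :=
  zsum (fun j => k j * (u (x + j) - u x)).

Definition Gamma2 (R : realType) (k : kernel R) (u : int -> R) (x : int) :
    \bar R :=
  ((4^-1 : R)%:E * \esum_(p in [set: int * int])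
    (k p.1 * k p.2 *
     (u (x + p.1 + p.2) - u (x + p.1) - u (x + p.2) + u x) ^+ 2)%:E)%E.

(* CD(0,d), meant for 0 < d *)
Definition CD0 (R : realType) (k : kernel R) (d : R) : Prop :=
  forall (x : int) (u : int -> R), admissible k u x ->
    ((d^-1 * gen k u x ^+ 2)%:E <= Gamma2 k u x)%E.

Definition power_fun (R : realType) (c beta : R) (j : int) : R :=
  if j == 0 then 0 else c / (`|j|%:~R `^ (1 + beta)).

Section power_kernel.
Variables (R : realType) (c beta : R).
Hypotheses (c_gt0 : 0 < c) (beta_gt0 : 0 < beta).

Let f := power_fun c beta.

Lemma power_fun_ge0 j : 0 <= f j.
Proof.
by rewrite /f /power_fun; case: eqP => // _; rewrite divr_ge0 ?powR_ge0 ?ltW.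
Qed.

Lemma power_fun0 : f 0 = 0. Proof. by rewrite /f /power_fun eqxx. Qed.

Lemma power_funN (j : nat) : f (- j%:Z) = f j%:Z.
Proof. by rewrite /f /power_fun oppr_eq0 normrN. Qed.

Lemma power_fun_mass_gt0 : (0 < \esum_(j in [set: int]) (f j)%:E)%E.
Proof.
have f1 : f 1 = c by rewrite /f /power_fun/= normr1 powR1 divr1.
apply: (@lt_le_trans _ _ (f 1)%:E); first by rewrite lte_fin f1.
apply: esum_ge; exists [set 1]; first by split.
by rewrite fsbig_set1.
Qed.

Lemma riemannR_telescope (n : nat) :
  riemannR (1 + beta) n.+1 <=
    beta^-1 * (n.+1%:R `^ (- beta) - n.+2%:R `^ (- beta)).
Proof.
have n1 : 0 < n.+1%:R :> R by [].
have n2 : 0 < n.+2%:R :> R by [].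
rewrite ler_pdivlMl// /riemannR powRD; last by rewrite lt0r_neq0 ?implybT.
rewrite powRr1 ?ler0n// invfM -powRN.
have -> : n.+1%:R `^ (- beta) =
    n.+2%:R `^ (- beta) * expR (beta * ln (n.+2%:R / n.+1%:R)) :> R.
  rewrite /powR !gt_eqF// -expRD ln_div ?posrE//; congr expR.
  by rewrite mulrBr !mulNr addKr.
rewrite -[X in _ - X]mulr1 -mulrBr mulrA mulrC ler_wpM2l ?powR_ge0//.
rewrite lerBrDl (le_trans _ (expR_ge1Dx _))// lerD2l ler_wpM2l ?(ltW beta_gt0)//.
rewrite -[n.+2%:R / _]invrK invf_div lnV ?posrE ?divr_gt0// lerNr.
have -> : n.+1%:R / n.+2%:R = 1 + - n.+2%:R^-1 :> R.
  apply: (mulIf (lt0r_neq0 n2)); rewrite divfK ?lt0r_neq0// mulrDl mul1r mulNr.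
  by rewrite mulVf ?lt0r_neq0// -[n.+2]addn1 natrD addrK.
by apply: le_ln1Dx; rewrite ltrN2 invf_lt1// ltr1n.
Qed.

Lemma series_riemannR_le (n : nat) :
  series (riemannR (1 + beta)) n <= 1 + beta^-1.
Proof.
suff H m : series (riemannR (1 + beta)) m.+1 + beta^-1 * m.+1%:R `^ (- beta)
    <= 1 + beta^-1.
  case: n => [|n].
    by rewrite /series/= big_geq// addr_ge0 ?invr_ge0 ?ltW.
  by apply: le_trans (H n); rewrite lerDl mulr_ge0 ?powR_ge0 ?invr_ge0 ?ltW.
elim: m => [|m IH].
  by rewrite /series/= big_nat1 /riemannR !powR1 invr1 mulr1.
apply: le_trans IH; rewrite /series/= big_nat_recr//= -addrA lerD2l.
by have := riemannR_telescope m; rewrite mulrBr -lerBrDr.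
Qed.

Lemma power_funE (n : nat) : f n.+1%:Z = c * riemannR (1 + beta) n.
Proof. by rewrite /f /power_fun. Qed.

Lemma power_fun_mass_nat : (\esum_(n in [set: nat]) (f n.+1%:Z)%:E < +oo)%E.
Proof.
rewrite -nneseries_esumT; last by move=> n; rewrite lee_fin power_fun_ge0.
apply: (@le_lt_trans _ _ (c * (1 + beta^-1))%:E); last exact: ltry.
apply: lime_le.
  by apply: is_cvg_nneseries => n _ _; rewrite lee_fin power_fun_ge0.
apply: nearW => n; rewrite sumEFin lee_fin.
under eq_bigr do rewrite power_funE.
by rewrite -mulr_sumr ler_wpM2l ?(ltW c_gt0)// series_riemannR_le.
Qed.

Lemma power_fun_mass_fin : (\esum_(j in [set: int]) (f j)%:E < +oo)%E.
Proof.
have f0 j : (0 <= (f j)%:E)%E by rewrite lee_fin power_fun_ge0.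
have fNegz n : f (Negz n) = f n.+1%:Z by rewrite NegzE power_funN.
rewrite (esumID (range Posz)) ?setTI// (_ : ~` range Posz = range Negz); last first.
  apply/seteqP; split => [[n []|n _]|_ [n _ <-] []//]; last by exists n.
  by exists n.
rewrite !esum_image; [|by move=> ? ? _ _ [] ..].
have -> : \esum_(n in [set: nat]) (f (Negz n))%:E =
    \esum_(n in [set: nat]) (f n.+1%:Z)%:E.
  by apply: eq_esum => n _; rewrite fNegz.
rewrite lte_add_pinfty ?power_fun_mass_nat//.
rewrite (esumID (range S)) ?setTI// (_ : ~` range S = [set 0%N]); last first.
  apply/seteqP; split => [[//|n] []|_ -> [n _]//]; by exists n.
rewrite esum_set1//= power_fun0 adde0 esum_image ?power_fun_mass_nat//.
by move=> ? ? _ _ [].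
Qed.

Definition power_kernel : kernel R :=
  Kernel power_fun_ge0 power_fun0 power_funN power_fun_mass_gt0
    power_fun_mass_fin.

End power_kernel.

(* Main.v *)
Require Import Defs.
From mathcomp Require Import all_boot all_order all_algebra.
From mathcomp Require Import all_classical all_reals all_analysis.
From mathcomp Require Import ring lra.

(** The test functions are the powers [u j = |j| ^ (beta - e)], whose growth is
    just below the critical exponent [beta] at which [L u] stops being defined.
    At the origin, where [u] vanishes,
      [L u 0 = c * \sum_(j != 0) |j| ^ (-1 - e) = 2 * c * zeta (1 + e)],
    which blows up as [e] tends to 0.  The point is that [Gamma2 u 0] blows up
    no faster than [L u 0] itself, so that it cannot dominate its square.

    The double sum defining [Gamma2 u 0] is split along [|l| <= |j|] and
    [|j| <= |l|].  On the first half, [u (j + l) - u j] is at most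
    of order [|l| * |j| ^ (beta - e - 1)], and [u l] is harmless too: for every
    [a <= 1] with [a <= beta - e],
      [(u (j + l) - u j - u l) ^ 2
         <= 16 * |l| ^ (2 a) * |j| ^ (2 (beta - e - a))]
    (lemma [powR_defect]).  If moreover [s = 2 a - beta] is positive, then the
    sum over [|l| <= |j|] of [|l| ^ (-1 - beta) * |l| ^ (2 a) = |l| ^ (s - 1)]
    is governed by its large terms and contributes [|j| ^ s] up to a constant
    (lemma [sum_powR_le]); what remains is the sum over [j] of
    [|j| ^ (-1 - 2 e)].  Hence
    [Gamma2 u 0 <= C * zeta (1 + 2 e) <= C * zeta (1 + e)], with [C]
    independent of [e] (lemma [Gamma2_abs_pow]).  An exponent [a] with
    [beta / 2 < a <= 1] exists exactly because [beta < 2]; it can be taken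
    below [beta - e] for all small [e].

    CD(0,d) would now give [zeta (1 + e) <= C'] for all small [e], whereas the
    divergence of the harmonic series makes [zeta (1 + e)] unbounded
    (lemma [zeta_sum_unbounded]). *)

Set Implicit Arguments.
Unset Strict Implicit.
Unset Printing Implicit Defensive.
Import Order.TTheory GRing.Theory Num.Theory.
Local Open Scope classical_set_scope.
Local Open Scope ring_scope.

(** * Sums over the integers of even functions *)

Lemma esum_int_absz (R : realType) (g : nat -> \bar R) :
  (forall n, (0 <= g n)%E) -> g 0%N = 0%E ->
  (\esum_(j in [set: int]) g `|j|%N =
   \sum_(n <oo) g n.+1 + \sum_(n <oo) g n.+1)%E.
Proof.
move=> g0 g00; rewrite !nneseries_esumT//.
rewrite (esumID (range Posz)) ?setTI//.
have -> : ~` range Posz = range Negz.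
  apply/seteqP; split => [[n []|n _]|_ [n _ <-] []//]; last by exists n.
  by exists n.
rewrite !esum_image; [|by move=> ? ? _ _ [] ..].
congr (_ + _)%E.
rewrite (esumID (range S)) ?setTI//.
have -> : ~` range S = [set 0%N].
  by apply/seteqP; split => [[//|n] []|_ -> [n _]//]; exists n.
rewrite esum_set1//= g00 adde0 esum_image//.
by move=> ? ? _ _ [].
Qed.

(** * Elementary estimates on powers *)

Section powers.
Variable R : realType.
Implicit Types x y g a s e : R.

(** Between the exponents 0 and 2 the power [x `^ g] lies between [1] and
    [x ^+ 2], on either side of [x = 1]; this replaces a mean value argument
    uniform in [g]. *)
Lemma powR_dist1 x g : 0 <= x -> 0 <= g <= 2 ->
  `|x `^ g - 1| <= `|x ^+ 2 - 1|.
Proof.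
move=> x0 /andP[g0 g2].
have [->|xN0] := eqVneq x 0.
  rewrite expr0n/= sub0r normrN1.
  have [->|gN0] := eqVneq g 0; first by rewrite powRr0 subrr normr0 ler01.
  by rewrite powR0// sub0r normrN1.
have xp : 0 < x by rewrite lt_neqAle eq_sym xN0.
rewrite -(powR_mulrn 2 x0); have [x1|/ltW x1] := leP 1 x.
  have h1 : 1 <= x `^ g by rewrite -(powRr0 x) ler_powR.
  have h2 : x `^ g <= x `^ 2%:R by rewrite ler_powR.
  by rewrite !ger0_norm ?subr_ge0 ?lerD2r// (le_trans h1).
have h1 : x `^ g <= 1 by rewrite -(powRr0 x) ger_powR// xp.
have h2 : x `^ 2%:R <= x `^ g by rewrite ger_powR// xp.
by rewrite !ler0_norm ?subr_le0 ?lerN2 ?lerD2r// (le_trans h2).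
Qed.

(** The case [x = 1] of [powR_defect], to which homogeneity reduces it.  The
    constant is [3 + 1]: [|1 + t| `^ g - 1] is bounded by
    [|(1 + t) ^+ 2 - 1| <= 3 |t|], and both [|t|] and [|t| `^ g] are at most
    [|t| `^ a] because [|t| <= 1]. *)
Lemma powR_defect1 t g a : t != 0 -> `|t| <= 1 -> 0 <= a <= 1 -> a <= g <= 2 ->
  `| `|1 + t| `^ g - 1 - `|t| `^ g| <= 4 * `|t| `^ a.
Proof.
move=> t0 t1 /andP[a0 a1] /andP[ag g2].
have tp : 0 < `|t| <= 1 by rewrite normr_gt0 t0.
have h1 : `|t| `^ g <= `|t| `^ a by rewrite ger_powR.
have h2 : `|t| <= `|t| `^ a by rewrite ger1_powR.
have h3 : `| `|1 + t| `^ g - 1| <= 3 * `|t|.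
  apply: (le_trans (powR_dist1 (normr_ge0 _) _)).
    by rewrite g2 (le_trans a0).
  rewrite real_normK ?num_real//.
  have -> : (1 + t) ^+ 2 - 1 = (2 + t) * t by ring.
  rewrite normrM ler_wpM2r// (le_trans (ler_normD _ _))//.
  by rewrite ger0_norm//; lra.
have h4 : 0 <= `|t| `^ g by exact: powR_ge0.
apply: (le_trans (ler_normB _ _)); rewrite (ger0_norm h4); lra.
Qed.

(** How far [|.| `^ g] is from being additive.  The smaller argument enters with
    an exponent [a] that may be chosen, up to [min 1 g]; this freedom
    is what makes the double sum in [Gamma2] converge. *)
Lemma powR_defect x y g a : y != 0 -> `|y| <= `|x| -> 0 <= a <= 1 ->
    a <= g <= 2 ->
  (`|x + y| `^ g - `|x| `^ g - `|y| `^ g) ^+ 2 <=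
    16 * (`|y| `^ (2 * a) * `|x| `^ (2 * (g - a))).
Proof.
move=> y0 yx a01 ag2.
have xp : 0 < `|x| by rewrite (lt_le_trans _ yx) ?normr_gt0.
have x0 : x != 0 by rewrite -normr_gt0.
have yE : y = x * (y / x) by rewrite mulrC divfK.
have t0 : y / x != 0 by rewrite mulf_neq0 ?invr_eq0.
have t1 : `|y / x| <= 1 by rewrite normrM normfV ler_pdivrMr// mul1r.
have H := powR_defect1 t0 t1 a01 ag2.
have -> : `|x + y| `^ g - `|x| `^ g - `|y| `^ g =
    `|x| `^ g * (`|1 + y / x| `^ g - 1 - `|y / x| `^ g).
  by rewrite !mulrBr mulr1 -!powRM// -!normrM mulrDr mulr1 -yE.
have -> : 16 * (`|y| `^ (2 * a) * `|x| `^ (2 * (g - a))) =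
    (`|x| `^ g * (4 * `|y / x| `^ a)) ^+ 2.
  rewrite {1}yE normrM powRM// ![2 * _]mulrC !powRrM.
  rewrite powRB; last by rewrite (gt_eqF xp) implybT.
  rewrite !powR_mulrn ?divr_ge0 ?powR_ge0//.
  have : `|x| `^ a != 0 by rewrite gt_eqF ?powR_gt0.
  by move=> ?; field.
rewrite -real_normK ?num_real// ler_sqr ?nnegrE ?mulr_ge0 ?powR_ge0//.
by rewrite normrM ger0_norm ?powR_ge0// ler_wpM2l ?powR_ge0.
Qed.

(** Discrete form of [\int_0^n x ^ (s - 1) dx = n ^ s / s].  The telescoping
    estimate behind it is
    [((N - 1) / N) ^ s <= expR (- s / N) <= (1 + s / N)^-1]. *)
Lemma sum_powR_le s n : 0 < s ->
  \sum_(0 <= i < n) i.+1%:R `^ (s - 1) <= (1 + s) / s * n%:R `^ s :> R.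
Proof.
move=> s0.
have c0 : 0 <= (1 + s) / s by rewrite divr_ge0 ?addr_ge0 ?(ltW s0).
elim: n => [|n IH].
  by rewrite big_geq// mulr_ge0 ?powR_ge0.
rewrite big_nat_recr//=.
have n1 : 0 < n.+1%:R :> R by [].
have n1s : 0 < n.+1%:R `^ s :> R by rewrite powR_gt0.
suff H : n%:R `^ s <= n.+1%:R `^ s * (n.+1%:R / (n.+1%:R + s)) :> R.
  apply: le_trans (lerD IH (lexx _)) _.
  rewrite powRB; last by rewrite (gt_eqF n1) implybT.
  rewrite powRr1 ?ler0n//.
  apply: (@le_trans _ _ ((1 + s) / s *
     (n.+1%:R `^ s * (n.+1%:R / (n.+1%:R + s))) + n.+1%:R `^ s / n.+1%:R)).
    by rewrite lerD2r ler_wpM2l.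
  rewrite mulrCA -!mulrDr mulrC ler_wpM2r ?powR_ge0//.
  have n1' : 1 <= n.+1%:R :> R by rewrite ler1n.
  rewrite -subr_ge0.
  move: (n.+1%:R : R) n1 n1' => N n1 n1'.
  have -> : (1 + s) / s - ((1 + s) / s * (N / (N + s)) + N^-1) =
     s * (N - 1) / (N * (N + s)).
    by field; rewrite !gt_eqF ?addr_gt0.
  by rewrite divr_ge0 ?mulr_ge0 ?subr_ge0 ?addr_ge0 ?(ltW s0) ?(ltW n1).
have -> : n.+1%:R / (n.+1%:R + s) = (1 + s / n.+1%:R)^-1 :> R.
  by rewrite -invf_div mulrDl divff ?lt0r_neq0.
case: n {IH} n1 n1s => [|n] n1 n1s.
  rewrite powR0 ?gt_eqF// mulr_ge0 ?powR_ge0//.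
  by rewrite invr_ge0 addr_ge0 ?divr_ge0 ?(ltW s0).
rewrite ler_pdivlMr ?addr_gt0 ?divr_gt0//.
apply: (@le_trans _ _ (n.+1%:R `^ s * expR (s / n.+2%:R))).
  by rewrite ler_wpM2l ?powR_ge0// expR_ge1Dx.
rewrite /powR !gt_eqF// -expRD ler_expR -mulrDr ler_wpM2l ?(ltW s0)//.
have m1 : 0 < n.+1%:R :> R by [].
have q : 0 < n.+1%:R / n.+2%:R :> R by rewrite divr_gt0.
have := @le_ln1Dx R (- n.+2%:R^-1).
have -> : 1 + - n.+2%:R^-1 = n.+1%:R / n.+2%:R :> R.
  have : n.+1%:R + 1 != 0 :> R by rewrite natr1 gt_eqF.
  by rewrite -(natr1 n.+1); move: (n.+1%:R : R) => N ?; field.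
rewrite ln_div ?posrE// ltrN2 invf_lt1// ltr1n => /(_ isT).
by rewrite lerBlDr [- _ + _]addrC lerBrDr.
Qed.

End powers.

(** * The sum of n ^ (- (1 + e)) as e tends to 0 *)

Section zeta.
Variable R : realType.
Implicit Types e M : R.

(** The value of the Riemann zeta function at [1 + e], for [0 < e]. *)
Definition zeta_sum (e : R) : \bar R :=
  (\sum_(n <oo) (n.+1%:R `^ (- (1 + e)))%:E)%E.

Lemma zeta_sum_fin e : 0 < e -> (zeta_sum e < +oo)%E.
Proof.
move=> e0; apply: (@le_lt_trans _ _ (1 + e^-1)%:E); last exact: ltry.
apply: lime_le.
  by apply: is_cvg_nneseries => n _ _; rewrite lee_fin powR_ge0.
apply: nearW => n; rewrite sumEFin lee_fin.
under eq_bigr do rewrite powRN.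
exact: series_riemannR_le.
Qed.

Lemma zeta_sum_ge0 e : (0 <= zeta_sum e)%E.
Proof. by apply: nneseries_ge0 => n _ _; rewrite lee_fin powR_ge0. Qed.

Lemma zeta_sum_le e e' : e <= e' -> (zeta_sum e' <= zeta_sum e)%E.
Proof.
move=> ee; apply: lee_nneseries => n _; first by rewrite lee_fin powR_ge0.
by rewrite lee_fin ler_powR ?ler1n// lerN2 lerD2l.
Qed.

(** Take [N] with harmonic sum at least [2 M]; for [e] small against
    [1 / ln N] each of its terms loses at most half of its value when the
    exponent changes from [-1] to [- (1 + e)]. *)
Lemma sum_powR_unbounded (M : R) : exists2 e0, 0 < e0 &
  forall e, 0 < e <= e0 ->
    exists N, M <= \sum_(0 <= i < N) i.+1%:R `^ (- (1 + e)).
Proof.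
have [N HN] : exists N, 2 * M <= series (@harmonic R) N.
  apply: contrapT => /forallNP H; apply: (@dvg_harmonic R).
  apply: nondecreasing_is_cvgn.
    apply/nondecreasing_seqP => n.
    by rewrite /series/= big_nat_recr//= lerDl harmonic_ge0.
  by exists (2 * M) => _ [n _ <-]; have /negP := H n; rewrite -ltNge => /ltW.
have [M0|M0] := ltP 0 M; last first.
  by exists 1 => // e _; exists 0%N; rewrite big_geq.
have L0 : 0 <= ln N.+1%:R :> R by rewrite ln_ge0// ler1n.
(* 1 + ln rather than ln, so that N = 0 does not divide by zero. *)
exists ((2 * (1 + ln N.+1%:R))^-1); first by rewrite invr_gt0; lra.
move=> e /andP[e0 ee]; exists N.
have he : e * ln N.+1%:R <= 2^-1.
  move: ee; rewrite -[_^-1]mul1r ler_pdivlMr; last by lra.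
  nra.
have -> : M = 2^-1 * (2 * M) by field.
apply: (le_trans (ler_wpM2l _ HN)) => //.
rewrite /series/= mulr_sumr ler_sum_nat// => i /andP[_ iN].
rewrite opprD powRD ?pnatr_eq0 ?implybT// powR_inv1// mulrC.
rewrite ler_wpM2l ?harmonic_ge0//.
apply: (@le_trans _ _ (1 + - e * ln i.+1%:R)); last first.
  by rewrite /powR pnatr_eq0/= expR_ge1Dx.
have : ln i.+1%:R <= ln N.+1%:R :> R by rewrite ler_ln ?posrE// ler_nat ltnW.
move=> h; have : e * ln i.+1%:R <= e * ln N.+1%:R by rewrite ler_wpM2l// ltW.
lra.
Qed.

Lemma zeta_sum_unbounded M : exists2 e0, 0 < e0 &
  forall e, 0 < e <= e0 -> (M%:E <= zeta_sum e)%E.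
Proof.
have [e0 e00 H] := sum_powR_unbounded M; exists e0 => // e /H [N HN].
apply: (@le_trans _ _ (\sum_(0 <= i < N) (i.+1%:R `^ (- (1 + e)))%:E)%E).
  by rewrite sumEFin lee_fin.
by apply: nneseries_lim_ge => n _ _; rewrite lee_fin powR_ge0.
Qed.

End zeta.

(** * Sums of powers over the integers *)

Section int_sums.
Variable R : realType.
Implicit Types C e s : R.

Lemma esum_powR_absz (C e : R) : 0 <= C ->
  (\esum_(j in [set: int])
     (if j == 0 then 0 else C * `|j|%N%:R `^ (- (1 + e)))%:E =
   (2 * C)%:E * zeta_sum e)%E.
Proof.
move=> C0.
pose g n : \bar R := (if n == 0%N then 0 else C * n%:R `^ (- (1 + e)))%:E.
rewrite (@eq_esum _ _ _ _ (fun j : int => g `|j|%N)); last first.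
  by move=> j _; rewrite /g absz_eq0.
rewrite esum_int_absz//; last first.
  move=> n; rewrite /g lee_fin; case: ifP => // _.
  by rewrite mulr_ge0 ?powR_ge0.
rewrite /g/=; under eq_eseriesr do rewrite EFinM.
rewrite nneseriesZl; last by move=> n _; rewrite lee_fin powR_ge0.
rewrite -/(zeta_sum e) -ge0_muleDl ?zeta_sum_ge0 ?lee_fin//.
by rewrite -EFinD; congr (_%:E * _)%E; ring.
Qed.

(** The inner sum over [|l| <= |j|], with [m = |j|].  The factor [2] accounts
    for the two signs of [l]. *)
Lemma esum_int_powR_le (s : R) (m : nat) (C : R) : 0 < s -> 0 <= C ->
  (\esum_(l in [set: int])
     (if (0 < `|l| <= m)%N then C * `|l|%N%:R `^ (s - 1) else 0)%:E <=
   (2 * (C * ((1 + s) / s * m%:R `^ s)))%:E)%E.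
Proof.
move=> s0 C0.
pose g n : \bar R :=
  (if (0 < n <= m)%N then C * n%:R `^ (s - 1) else 0)%:E.
rewrite (@eq_esum _ _ _ _ (fun j : int => g `|j|%N))//.
have g0 n : (0 <= g n)%E.
  by rewrite /g lee_fin; case: ifP => // _; rewrite mulr_ge0 ?powR_ge0.
rewrite esum_int_absz//.
suff H : (\sum_(n <oo) g n.+1 <= (C * ((1 + s) / s * m%:R `^ s))%:E)%E.
  by rewrite mulr_natl mulr2n EFinD leeD.
rewrite (@nneseries_split _ _ 0 m)// add0n eseries0 ?adde0; last first.
  by move=> i /= mi _; rewrite /g /= ltnNge mi.
rewrite big_nat (eq_bigr (fun i => (C * i.+1%:R `^ (s - 1))%:E)); last first.
  by move=> i /andP[_ im]; rewrite /g/= im.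
rewrite -big_nat sumEFin lee_fin -mulr_sumr ler_wpM2l//.
exact: sum_powR_le.
Qed.

End int_sums.

(** * The operator and the iterated carre du champ on powers *)

Section power_functions.
Variables (R : realType) (c beta : R).
Hypotheses (c_gt0 : 0 < c) (beta_gt0 : 0 < beta).

Let k := power_kernel c_gt0 beta_gt0.

Lemma power_kernelE (j : int) : j != 0 ->
  k j = c * `|j|%N%:R `^ (- (1 + beta)).
Proof. by move=> j0; rewrite /k/= /power_fun (negPf j0) powRN pmulrn abszE. Qed.

Definition abs_pow (g : R) (j : int) : R := `|j|%N%:R `^ g.

Lemma abs_powE g j : abs_pow g j = `|j%:~R| `^ g.
Proof. by rewrite /abs_pow pmulrn abszE intr_norm. Qed.

Lemma kernel_abs_pow e (j : int) : e < beta ->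
  k j * abs_pow (beta - e) j =
  if j == 0 then 0 else c * `|j|%N%:R `^ (- (1 + e)).
Proof.
move=> eb; have [->|j0] := eqVneq j 0; first by rewrite kernel0 mul0r.
have j1 : `|j|%N%:R != 0 :> R by rewrite pnatr_eq0 absz_eq0.
rewrite power_kernelE// /abs_pow -mulrA -powRD ?j1 ?implybT//.
by congr (_ * _ `^ _); ring.
Qed.

Lemma abs_pow0 g : 0 < g -> abs_pow g 0 = 0.
Proof. by move=> g0; rewrite /abs_pow absz0 powR0 ?gt_eqF. Qed.

Lemma abs_pow_admissible e : 0 < e < beta ->
  admissible k (abs_pow (beta - e)) 0.
Proof.
move=> /andP[e0 eb]; rewrite /admissible.
under eq_esum => j _ do
  rewrite add0r ger0_norm ?powR_ge0// (kernel_abs_pow _ eb).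
rewrite (esum_powR_absz _ (ltW c_gt0)).
by rewrite lte_mul_pinfty ?lee_fin ?mulr_ge0 ?(ltW c_gt0)// zeta_sum_fin.
Qed.

Lemma gen_abs_pow e : 0 < e < beta ->
  gen k (abs_pow (beta - e)) 0 = 2 * c * fine (zeta_sum e).
Proof.
move=> /andP[e0 eb]; rewrite /gen /zsum.
have F j : k j * (abs_pow (beta - e) (0 + j) - abs_pow (beta - e) 0) =
    if j == 0 then 0 else c * `|j|%N%:R `^ (- (1 + e)).
  by rewrite add0r abs_pow0 ?subr_gt0// subr0 kernel_abs_pow.
have F0 j : 0 <= if j == 0 then 0 else c * `|j|%N%:R `^ (- (1 + e)).
  by case: ifP => // _; rewrite mulr_ge0 ?powR_ge0 ?ltW.
under eq_esum => j _ do rewrite F (max_idPl (F0 j)).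
under [X in _ - fine X]eq_esum => j _ do
  rewrite F max_r ?oppr_le0 ?F0//.
rewrite (esum_powR_absz _ (ltW c_gt0)) esum1// subr0 fineM//.
by rewrite fin_numElt zeta_sum_fin// (lt_le_trans _ (zeta_sum_ge0 _)).
Qed.

(** Bound for the terms of the half [|l| <= |j|] of the double sum, where
    [p = (j, l)] and [s = 2 a - beta]: the kernel weights have been absorbed
    into the exponents. *)
Definition majorant (s e : R) (p : int * int) : R :=
  if (0 < `|p.2| <= `|p.1|)%N then
    16 * c ^+ 2 * `|p.1|%N%:R `^ (- (1 + 2 * e + s)) * `|p.2|%N%:R `^ (s - 1)
  else 0.

Lemma majorant_ge0 s e p : 0 <= majorant s e p.
Proof.
rewrite /majorant; case: ifP => // _.
by rewrite !mulr_ge0 ?powR_ge0 ?(ltW c_gt0).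
Qed.

Lemma le_majorant a e (j l : int) : 0 <= a <= 1 -> a <= beta - e <= 2 ->
  (0 < `|l| <= `|j|)%N ->
  k j * k l * (abs_pow (beta - e) (j + l) - abs_pow (beta - e) j -
               abs_pow (beta - e) l) ^+ 2 <= majorant (2 * a - beta) e (j, l).
Proof.
move=> a01 ag /[dup] lj /andP[l0 lj'].
have j0 : j != 0 by rewrite -absz_eq0 -lt0n (leq_trans l0).
have l0' : l != 0 by rewrite -absz_eq0 -lt0n.
have jR : `|j|%N%:R != 0 :> R by rewrite pnatr_eq0 absz_eq0.
have lR : `|l|%N%:R != 0 :> R by rewrite pnatr_eq0 absz_eq0.
have yx : `|l%:~R| <= `|j%:~R| :> R.
  by rewrite -!intr_norm -!abszE -!pmulrn ler_nat.
have y0 : l%:~R != 0 :> R by rewrite intr_eq0.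
have := powR_defect y0 yx a01 ag.
rewrite !abs_powE intrD => H.
apply: le_trans (ler_wpM2l (mulr_ge0 (kernel_ge0 k _) (kernel_ge0 k _)) H) _.
rewrite !power_kernelE// /majorant/= lj.
rewrite -!intr_norm -!abszE -!pmulrn.
have -> : - (1 + 2 * e + (2 * a - beta)) =
   - (1 + beta) + 2 * (beta - e - a) :> R by ring.
have -> : 2 * a - beta - 1 = - (1 + beta) + 2 * a :> R by ring.
rewrite !(powRD (r := - (1 + beta))) ?jR ?lR ?implybT//.
rewrite le_eqVlt; apply/orP; left; apply/eqP; ring.
Qed.

(** Summing over [l] first turns the [- s] in the exponent of [|j|] into [0]. *)
Lemma esum_majorant s e : 0 < s ->
  (\esum_(p in [set: int * int]) (majorant s e p)%:E <=
   (64 * c ^+ 2 * ((1 + s) / s))%:E * zeta_sum (2 * e))%E.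
Proof.
move=> s0; have c2 : 0 <= c ^+ 2 by rewrite sqr_ge0.
have -> : [set: int * int] = [set: int] `*`` (fun=> [set: int]).
  by apply/seteqP; split.
rewrite -(@esum_esum _ _ _ _ _ (fun j l => (majorant s e (j, l))%:E))//;
  last by move=> *; rewrite lee_fin majorant_ge0.
have C0 : 0 <= 32 * c ^+ 2 * ((1 + s) / s).
  by rewrite !mulr_ge0 ?invr_ge0 ?addr_ge0 ?(ltW s0) ?(ltW c_gt0).
have -> : 64 * c ^+ 2 * ((1 + s) / s) = 2 * (32 * c ^+ 2 * ((1 + s) / s)).
  by ring.
rewrite -esum_powR_absz//; apply: le_esum => j _.
rewrite /majorant/=; have [->|j0] := eqVneq j 0.
  by rewrite esum1// => l _; case: `|l|%N.
set C := 16 * c ^+ 2 * _.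
have CC : 0 <= C by rewrite !mulr_ge0 ?powR_ge0 ?(ltW c_gt0).
apply: le_trans (esum_int_powR_le _ s0 CC) _.
rewrite lee_fin /C.
have jR : `|j|%N%:R != 0 :> R by rewrite pnatr_eq0 absz_eq0.
have -> : - (1 + 2 * e) = - (1 + 2 * e + s) + s :> R by ring.
rewrite powRD ?jR ?implybT//.
by rewrite le_eqVlt; apply/orP; left; apply/eqP; ring.
Qed.

(** By symmetry each half of the double sum is bounded by [esum_majorant]. The
    diagonal is counted twice, which only costs a constant; the factor of
    [zeta_sum] does not depend on [e]. *)
Lemma Gamma2_abs_pow a e (s := 2 * a - beta) :
  a <= 1 -> a <= beta - e <= 2 -> 0 < s ->
  (Gamma2 k (abs_pow (beta - e)) 0 <=
   (32 * c ^+ 2 * ((1 + s) / s))%:E * zeta_sum (2 * e))%E.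
Proof.
move=> a1 ag s0.
have a0 : 0 < a.
  by have : 0 < 2 * a - beta := s0; move: beta_gt0 => ? ?; lra.
have a01 : 0 <= a <= 1 by rewrite a1 ltW.
have g0 : 0 < beta - e by case/andP: ag => /(lt_le_trans a0).
have -> : 32 * c ^+ 2 * ((1 + s) / s) =
    4^-1 * (2 * (64 * c ^+ 2 * ((1 + s) / s))) by field; rewrite gt_eqF.
rewrite /Gamma2 EFinM -muleA lee_wpmul2l ?lee_fin ?invr_ge0//.
pose M p := (majorant s e p)%:E.
have M0 p : (0 <= M p)%E by rewrite lee_fin majorant_ge0.
have swap_bij : set_bij [set: int * int] [set: int * int]
    (fun p : int * int => (p.2, p.1)).
  split => // [[x1 y1] [x2 y2] _ _ [-> ->]//|[x y] _].
  by exists (y, x).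
apply: (@le_trans _ _ (\esum_(p in [set: int * int]) (M p + M (p.2, p.1)))%E).
  apply: le_esum => -[j l] _; rewrite [(j, l).1]/= [(j, l).2]/= lee_fin.
  rewrite abs_pow0// addr0 !add0r.
  have [j0|j0] := eqVneq j 0.
    by rewrite j0 kernel0 !mul0r addr_ge0 ?majorant_ge0.
  have [l0|l0] := eqVneq l 0.
    by rewrite l0 kernel0 mulr0 !mul0r addr_ge0 ?majorant_ge0.
  have [lj|/ltnW jl] := leqP `|l| `|j|.
    apply: ler_wpDr; first exact: majorant_ge0.
    by apply: le_majorant => //; rewrite lj absz_gt0 l0.
  apply: ler_wpDl; first exact: majorant_ge0.
  rewrite (mulrC (k j)) (addrC j) addrAC.
  by apply: le_majorant => //; rewrite jl absz_gt0 j0.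
rewrite esumD//.
rewrite -(reindex_esum _ _ _ M swap_bij).
have C0 : 0 <= 64 * c ^+ 2 * ((1 + s) / s).
  apply: mulr_ge0; first by rewrite mulr_ge0 ?sqr_ge0.
  exact: divr_ge0 (addr_ge0 ler01 (ltW s0)) (ltW s0).
rewrite mulr_natl mulr2n EFinD ge0_muleDl ?lee_fin//.
by rewrite leeD// esum_majorant.
Qed.

End power_functions.

Theorem theorem3p1 (R : realType) (c beta : R) (c_gt0 : 0 < c)
    (beta_gt0 : 0 < beta) (beta_lt2 : beta < 2) :
  forall d : R, 0 < d -> ~ CD0 (power_kernel c_gt0 beta_gt0) d.
Proof.
move=> d d0 CD.
(* The factor 3 / 4 leaves room on both sides: beta / 2 < a, and
   a <= beta - e as soon as e <= beta / 4. *)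
pose a := Num.min 1 (3 / 4 * beta).
have a1 : a <= 1 by rewrite ge_min lexx.
have a3 : a <= 3 / 4 * beta by rewrite ge_min lexx orbT.
have ab : beta < 2 * a.
  by rewrite /a; case: (leP 1 (3 / 4 * beta)) => ?; lra.
pose s := 2 * a - beta; have s0 : 0 < s by rewrite subr_gt0.
(* K is the bound on zeta (1 + e) that CD(0,d) implies. *)
pose K := 8 * d * ((1 + s) / s).
have [e0 e00 H] := zeta_sum_unbounded (K + 1).
pose e := Num.min e0 (beta / 4).
have ep : 0 < e by rewrite lt_min e00; lra.
have ee0 : e <= e0 by rewrite ge_min lexx.
have eb : e <= beta / 4 by rewrite ge_min lexx orbT.
have e_itv : 0 < e < beta by apply/andP; split; lra.
have := CD 0 _ (abs_pow_admissible c_gt0 beta_gt0 e_itv).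
rewrite gen_abs_pow//.
have ag : a <= beta - e <= 2 by apply/andP; split; lra.
move=> /le_trans /(_ (Gamma2_abs_pow c_gt0 beta_gt0 a1 ag s0)).
have c2 : 0 < c ^+ 2 by rewrite exprn_gt0.
have q0 : 0 < (1 + s) / s by rewrite divr_gt0// addr_gt0.
have le2 : (zeta_sum (2 * e) <= zeta_sum e)%E by apply: zeta_sum_le; lra.
have C0 : 0 <= 32 * c ^+ 2 * ((1 + s) / s).
  by apply: mulr_ge0 (mulr_ge0 _ (ltW c2)) (ltW q0).
have C0e : (0%:E <= (32 * c ^+ 2 * ((1 + s) / s))%:E)%E by rewrite lee_fin.
move=> /le_trans /(_ (lee_wpmul2l C0e le2)).
have := H e; rewrite ep ee0 => /(_ isT).
have := zeta_sum_fin ep; have := zeta_sum_ge0 e.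
case: (zeta_sum e) => [z| |]//= _ _.
rewrite lee_fin => Kz; rewrite -EFinM lee_fin => F.
have z0 : 0 < z.
  apply: lt_le_trans Kz; rewrite ltr_wpDl//.
  exact: mulr_ge0 (mulr_ge0 _ (ltW d0)) (ltW q0).
have : z <= K.
  have p : 0 < 4 * c ^+ 2 * z / d by rewrite divr_gt0 ?mulr_gt0.
  rewrite -(ler_pM2l p) /K.
  have -> : 4 * c ^+ 2 * z / d * z = d^-1 * (2 * c * z) ^+ 2 by ring.
  have -> : 4 * c ^+ 2 * z / d * (8 * d * ((1 + s) / s)) =
    32 * c ^+ 2 * ((1 + s) / s) * z by field; rewrite !gt_eqF.
  exact: F.
lra.
Qed.
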